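(* Let $\Omega$ be a domain in $\mathbb{R}^{d}$, different from $\mathbb{R}^d$, and let $\mathsf{H}\le \operatorname{SL}_d(\mathbb{R})\ltimes \mathbb{R}^{d}$ be a group acting properly and cocompactly on $\Omega$. Denote by $L(\mathsf{H})$ the linear part of $\mathsf{H}$. Assume there exist $1 \leq p \leq d-1$ and a closed $L(\mathsf{H})$-invariant subset $\mathcal{F}$ of $\operatorname{Gr}_{p}(\mathbb{R}^d)$ such that: (1) for all $g \in L(\mathsf{H})$, there exists an element of $\mathcal{F}$ which is not contracted by $g$; (2) if $x,y \in \mathcal{F}$ are distinct, then $x+y = \mathbb{R}^d$. Then there exists $F$ in $\mathcal{F}$ that is $L(\mathsf{H})$-invariant, and $\Omega$ is foliated by affine subspaces parallel to $F$.
   Context: A domain is a nonempty connected open subset. $\operatorname{SL}_d(\mathbb{R})\ltimes\mathbb{R}^d$ acts on $\mathbb{R}^d$ by affine transformations; $L(\mathsf{H})\le\operatorname{SL}_d(\mathbb{R})$ is the image of $\mathsf{H}$ under the projection to the linear part. $\operatorname{Gr}_p(\mathbb{R}^d)$ is the Grassmannian of $p$-dimensional linear subspaces of $\mathbb{R}^d$, with the natural action of $\operatorname{SL}_d(\mathbb{R})$. Fix the Euclidean norm $|\cdot|$ on $\mathbb{R}^d$. An element $g\in\operatorname{SL}_d(\mathbb{R})$ does not contract a subspace $F\subset\mathbb{R}^d$ (and $F$ is not contracted by $g$) if $|g\cdot x|\ge |x|$ for all $x\in F$. ''$\Omega$ is foliated by affine subspaces parallel to $F$'' means that for every $x\in\Omega$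 the affine subspace $x+F$ is contained in $\Omega$. *)

(* Defs.v *)
From HB Require Import structures.
From mathcomp Require Import all_boot all_order all_algebra.
From mathcomp Require Import all_classical all_reals all_analysis.
Set Implicit Arguments.
Unset Strict Implicit.
Unset Printing Implicit Defensive.
Import Order.TTheory GRing.Theory Num.Theory.
Import numFieldNormedType.Exports.
Local Open Scope classical_set_scope.
Local Open Scope ring_scope.

(* Column vectors ['cV[R]_d] are the points of R^d.  Their canonical topology
   is the usual one, but the canonical norm [`|x|] is the sup norm. *)
Definition enorm (R : realType) (d : nat) (x : 'cV[R]_d) : R :=
  Num.sqrt (\sum_(i < d) x i 0 ^+ 2).

Definition domain (T : topologicalType) (A : set T) : Prop :=
  [/\ A !=set0, connected A & open A].

Section SpecialLinear.
Variables (R : realType) (d : nat).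

(* As a [set_type], SL_d(R) carries the topology induced by ['M[R]_d]. *)
Definition SL : Type := set_type [set A : 'M[R]_d | \det A = 1].

HB.instance Definition _ := SubType.copy SL
  (set_type [set A : 'M[R]_d | \det A = 1]).
HB.instance Definition _ := Topological.copy SL
  (set_type [set A : 'M[R]_d | \det A = 1]).

Definition SL_of (A : 'M[R]_d) (h : \det A = 1) : SL :=
  exist _ A (mem_set h).

Lemma det_SL (g : SL) : \det (\val g) = 1.
Proof. exact: (set_mem (valP g)). Qed.

Lemma unitmx_SL (g : SL) : \val g \in unitmx.
Proof. by rewrite unitmxE det_SL unitr1. Qed.

Lemma SL_mul_subproof (g h : SL) : \det (\val g *m \val h) = 1.
Proof. by rewrite det_mulmx !det_SL mulr1. Qed.

Lemma SL_inv_subproof (g : SL) : \det (invmx (\val g)) = 1.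
Proof. by rewrite det_inv det_SL invr1. Qed.

Definition SL_one : SL := SL_of (det1 R d).
Definition SL_mul (g h : SL) : SL := SL_of (SL_mul_subproof g h).
Definition SL_inv (g : SL) : SL := SL_of (SL_inv_subproof g).

Lemma SL_mulA : associative SL_mul.
Proof. by move=> f g h; apply: val_inj; rewrite /= mulmxA. Qed.
Lemma SL_mul1 : left_id SL_one SL_mul.
Proof. by move=> g; apply: val_inj; rewrite /= mul1mx. Qed.
Lemma SL_mulg1 : right_id SL_one SL_mul.
Proof. by move=> g; apply: val_inj; rewrite /= mulmx1. Qed.
Lemma SL_mulV : left_inverse SL_one SL_inv SL_mul.
Proof. by move=> g; apply: val_inj; rewrite /= mulVmx ?unitmx_SL. Qed.
Lemma SL_mulgV : right_inverse SL_one SL_inv SL_mul.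
Proof. by move=> g; apply: val_inj; rewrite /= mulmxV ?unitmx_SL. Qed.

HB.instance Definition _ :=
  isGroup.Build SL SL_mulA SL_mul1 SL_mulg1 SL_mulV SL_mulgV.

End SpecialLinear.

Section SpecialAffine.
Variables (R : realType) (d : nat).

(* SL_d(R) |x R^d with the product topology; [(A, b)] stands for the affine
   map [x |-> A x + b]. *)
Definition SAff : Type := (SL R d * 'cV[R]_d)%type.

HB.instance Definition _ := Topological.copy SAff (SL R d * 'cV[R]_d)%type.

Definition saff_act (h : SAff) (x : 'cV[R]_d) : 'cV[R]_d :=
  \val h.1 *m x + h.2.

Definition SAff_one : SAff := (1%g, 0).
Definition SAff_mul (g h : SAff) : SAff :=
  ((g.1 * h.1)%g, \val g.1 *m h.2 + g.2).
Definition SAff_inv (g : SAff) : SAff :=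
  ((g.1^-1)%g, - (\val (g.1^-1)%g *m g.2)).

Lemma SAff_mulA : associative SAff_mul.
Proof.
move=> f g h; rewrite /SAff_mul /= mulgA; congr pair.
by rewrite mulmxDr mulmxA addrA.
Qed.
Lemma SAff_mul1 : left_id SAff_one SAff_mul.
Proof. by case=> A b; rewrite /SAff_mul /= mul1g mul1mx addr0. Qed.
Lemma SAff_mulg1 : right_id SAff_one SAff_mul.
Proof. by case=> A b; rewrite /SAff_mul /= mulg1 mulmx0 add0r. Qed.
Lemma SAff_mulV : left_inverse SAff_one SAff_inv SAff_mul.
Proof. by case=> A b; rewrite /SAff_mul /SAff_inv /= mulVg subrr. Qed.
Lemma SAff_mulgV : right_inverse SAff_one SAff_inv SAff_mul.
Proof.
case=> A b; rewrite /SAff_mul /SAff_inv /= mulgV mulmxN mulmxA.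
by rewrite mulmxV ?unitmx_SL // mul1mx addNr.
Qed.

HB.instance Definition _ :=
  isGroup.Build SAff SAff_mulA SAff_mul1 SAff_mulg1 SAff_mulV SAff_mulgV.

Lemma saff_act1 : saff_act 1%g =1 id.
Proof. by move=> x; rewrite /saff_act mul1mx addr0. Qed.

Lemma saff_actM (g h : SAff) (x : 'cV[R]_d) :
  saff_act (g * h)%g x = saff_act g (saff_act h x).
Proof. by rewrite /saff_act /= mulmxDr mulmxA addrA. Qed.

Definition linear_part (H : set SAff) : set (SL R d) := fst @` H.

Definition preserves (H : set SAff) (Omega : set 'cV[R]_d) : Prop :=
  forall h, H h -> saff_act h @` Omega = Omega.

(* Properness for the topology induced on [H] by SL_d(R) |x R^d; compactness
   of a subset of [H] does not depend on whether it is taken in [H] or in the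
   ambient group. *)
Definition acts_properly_on (H : set SAff) (Omega : set 'cV[R]_d) : Prop :=
  forall K : set 'cV[R]_d, compact K -> K `<=` Omega ->
    compact [set h | H h /\ saff_act h @` K `&` K !=set0].

Definition acts_cocompactly_on (H : set SAff) (Omega : set 'cV[R]_d) : Prop :=
  exists K : set 'cV[R]_d, [/\ compact K, K `<=` Omega &
    \bigcup_(h in H) (saff_act h @` K) = Omega].

End SpecialAffine.

Section Grassmannian.
Variables (R : realType) (d p : nat).

Definition Gr : Type := {F : {vspace 'cV[R]_d} | \dim F == p}.

HB.instance Definition _ := SubType.copy Gr
  {F : {vspace 'cV[R]_d} | \dim F == p}.
HB.instance Definition _ := Choice.copy Gr
  {F : {vspace 'cV[R]_d} | \dim F == p}.

Definition columns (A : 'M[R]_(d, p)) : p.-tuple 'cV[R]_d :=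
  [tuple col j A | j < p].

(* p-frames of R^d, i.e. d x p matrices with linearly independent columns *)
Definition Stiefel : Type := set_type [set A : 'M[R]_(d, p) | free (columns A)].

HB.instance Definition _ := Topological.copy Stiefel
  (set_type [set A : 'M[R]_(d, p) | free (columns A)]).

Lemma dim_columns (A : Stiefel) : \dim <<columns (\val A)>>%VS == p.
Proof.
have : free (columns (\val A)) := set_mem (valP A).
by rewrite /free size_tuple.
Qed.

Definition frame_span (A : Stiefel) : Gr :=
  Sub <<columns (\val A)>>%VS (dim_columns A).

(* The topology of the Grassmannian is the quotient topology of the space of
   frames. *)
Definition Gr_open (U : set Gr) : Prop := open (frame_span @^-1` U).

Lemma Gr_openT : Gr_open setT.
Proof. exact: openT. Qed.
Lemma Gr_openI : setI_closed Gr_open.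
Proof. by move=> U V; exact: openI. Qed.
Lemma Gr_open_bigU (I : Type) (f : I -> set Gr) :
  (forall i, Gr_open (f i)) -> Gr_open (\bigcup_i f i).
Proof. by move=> fo; apply: bigcup_open => i _; exact: fo. Qed.

HB.instance Definition _ :=
  isOpenTopological.Build Gr Gr_openT Gr_openI Gr_open_bigU.

Lemma dim_SL_img (g : SL R d) (F : Gr) :
  \dim (linfun (mulmx (\val g)) @: \val F)%VS == p.
Proof.
rewrite limg_dim_eq ?(valP F) //; apply/eqP; rewrite -subv0.
apply/subvP => v; rewrite memv_cap memv_ker lfunE memv0 => /andP[_ /eqP gv0].
by rewrite -[v](mulKmx (unitmx_SL g)) gv0 mulmx0.
Qed.

Definition Gr_act (g : SL R d) (F : Gr) : Gr :=
  Sub (linfun (mulmx (\val g)) @: \val F)%VS (dim_SL_img g F).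

Definition Gr_invariant (L : set (SL R d)) (X : set Gr) : Prop :=
  forall g, L g -> Gr_act g @` X = X.

End Grassmannian.

Definition not_contracted (R : realType) (d : nat) (g : SL R d)
    (F : {vspace 'cV[R]_d}) : Prop :=
  forall x, x \in F -> enorm x <= enorm (\val g *m x).

Definition foliated_parallel (R : realType) (d : nat) (Omega : set 'cV[R]_d)
    (F : {vspace 'cV[R]_d}) : Prop :=
  forall x, Omega x -> [set x + v | v in [set` F]] `<=` Omega.

(* Main.v *)
Require Import Defs.
From mathcomp Require Import all_boot all_order all_algebra.
From mathcomp Require Import ring lra.
From mathcomp Require Import all_classical all_reals all_analysis.
Import numFieldNormedType.Exports.
Import Order.TTheory GRing.Theory Num.Theory.
Local Open Scope classical_set_scope.
Local Open Scope ring_scope.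

(** Choose a compact [K] in [Omega] whose translates cover [Omega], and [eps]
    such that the [eps]-ball around each point of [K] stays in [Omega].  If
    [x = h k] with [k] in [K], and [F0] in [FF] is not contracted by the linear
    part [g] of [h], then each [v] in [F = g F0] is [g w] with [w] no longer
    than [v], so that [x + v = h (k + w)].  Hence every point of [Omega] is the
    centre of a disc of [Omega], of a radius that depends only on [eps] and
    [d], parallel to a member of [FF] ([pushed_plane], [pushed_in]).

    Let [x] tend to a boundary point [y].  By compactness of the Grassmannian
    these planes accumulate on some [F] in [FF], a limit plane at [y]
    ([limit_plane_exists]).  The disc of [y + F] lies in the boundary
    ([limit_plane_boundary]): it is a limit of discs of [Omega], and if it had a
    point [y + v] in [Omega], then the elements [h], which carry [k] near [y]
    and [k + w] near [y + v], would stay in a compact subset of [H] by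
    properness, so that [y], as a limit of points [h k], would be in [Omega].

    Transversality now makes the limit plane rigid ([limit_plane_eq]): if a disc
    through [y] parallel to [G] in [FF] misses [Omega], then [G = F], as
    otherwise it would be transverse to the discs of [Omega] at points close to
    [y] and would meet them.  So the limit plane is constant along the disc of
    [y + F]; as the radius does not depend on [y], the whole leaf [y + F] lies
    in the boundary with constant limit plane ([leaf]).  Leaves with different
    directions would intersect, so the direction [F] is the same at all boundary
    points ([limit_plane_unique]) and is therefore invariant under the linear
    part of [H].  Since the boundary is a union of affine subspaces parallel to
    [F], no segment in direction [F] leaves [Omega]. *)

(** * Topology of matrix spaces *)

Section MatrixTopology.
Set Implicit Arguments.
Unset Strict Implicit.
Context {R : realType}.
Implicit Types m n p : nat.

Lemma continuous_coords (T : topologicalType) m n (f : T -> 'M[R]_(m, n)) :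
  (forall i j, continuous (fun t => f t i j)) -> continuous f.
Proof.
move=> fc t; apply/cvg_ballP => e e0.
suff : \forall x \near t, forall i j, ball (f t i j) e (f x i j).
  by apply: filterS => x; rewrite /ball /= /mx_ball.
apply: filter_forall => i; apply: filter_forall => j.
exact: (cvg_ball (fc i j t) e0).
Qed.

Lemma continuous_mulmx (T : topologicalType) m n p
    (f : T -> 'M[R]_(m, n)) (g : T -> 'M[R]_(n, p)) :
  continuous f -> continuous g -> continuous (fun t => f t *m g t).
Proof.
move=> fc gc; apply: continuous_coords => i j t.
under eq_fun do rewrite mxE.
apply: cvg_big => [|k _]; first exact: add_continuous.
apply: cvgM.
  apply: (@continuous_comp _ _ _ f (fun M => M i k)); first exact: fc.
  exact: coord_continuous.
apply: (@continuous_comp _ _ _ g (fun M => M k j)); first exact: gc.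
exact: coord_continuous.
Qed.

Lemma continuous_saff_act d :
  continuous (fun hx : SAff R d * 'cV[R]_d => saff_act hx.1 hx.2).
Proof.
have lin : continuous (fun h : SAff R d => \val h.1 : 'M[R]_d).
  move=> z; refine (@continuous_comp _ _ _ (fun h : SAff R d => h.1 : SL R d)
    (fun g : SL R d => \val g : 'M[R]_d) z _ _); first exact: cvg_fst.
  exact: initial_continuous.
have fstc : continuous (@fst (SAff R d) 'cV[R]_d) by move=> z; exact: cvg_fst.
have valc : continuous (fun hx : SAff R d * 'cV[R]_d => \val hx.1.1).
  by move=> z; exact: (continuous_comp (fstc z) (lin _)).
have sndc : continuous (@snd (SAff R d) 'cV[R]_d) by move=> z; exact: cvg_snd.
have transc : continuous (fun hx : SAff R d * 'cV[R]_d => hx.1.2).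
  move=> z; refine (@continuous_comp _ _ _ fst (fun h : SAff R d => h.2) z _ _).
    exact: fstc.
  exact: cvg_snd.
have mc := continuous_mulmx valc sndc.
by move=> z; exact: (@cvgD _ _ _ _ (nbhs_filter z) _ _ _ _ (mc z) (transc z)).
Qed.

Lemma norm_mx_le m n (A : 'M[R]_(m, n)) (c : R) :
  0 <= c -> (forall i j, `|A i j| <= c) -> `|A| <= c.
Proof.
move=> c0 Ac; rewrite [leLHS]mx_normrE; exact: bigmax_le.
Qed.

Lemma entry_le_norm m n (A : 'M[R]_(m, n)) i j : `|A i j| <= `|A|.
Proof.
by rewrite [leRHS]mx_normrE; apply/bigmax_geP; right; exists (i, j).
Qed.

Lemma norm_mulmx_le m n p (A : 'M[R]_(m, n)) (B : 'M[R]_(n, p)) :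
  `|A *m B| <= n%:R * (`|A| * `|B|).
Proof.
apply: norm_mx_le => [|i j]; first by rewrite !mulr_ge0.
rewrite mxE; apply: (le_trans (ler_norm_sum _ _ _)).
rewrite -[n in n%:R]card_ord mulr_natl -sumr_const.
by apply: ler_sum => k _; rewrite normrM ler_pM// entry_le_norm.
Qed.

(** Heine-Borel for rectangular matrices, read off from row vectors through
    the flattening [mxvec]. *)
Lemma bounded_closed_compact_mx m n (S : set 'M[R]_(m, n)) (c : R) :
  (forall A, S A -> `|A| <= c) -> closed S -> compact S.
Proof.
move=> Sc Scl.
have vc : continuous (@vec_mx R m n).
  apply: continuous_coords => i j; under eq_fun do rewrite mxE.
  exact: coord_continuous.
have -> : S = vec_mx @` (vec_mx @^-1` S).
  rewrite eqEsubset; split => [A SA|_ [v Sv <-]//].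
  by exists (mxvec A); rewrite /= mxvecK.
apply: continuous_compact; first exact: continuous_subspaceT.
apply: bounded_closed_compact; last first.
  by move/continuous_closedP : vc; apply.
exists c; split; first exact: num_real.
move=> x cx v /= Sv; apply: le_trans (ltW cx).
apply: le_trans (Sc _ Sv); apply: norm_mx_le => // i j.
rewrite ord1 -[v]vec_mxK; case/mxvec_indexP: j => j k.
by rewrite mxvecE mxvecK entry_le_norm.
Qed.

End MatrixTopology.

(** * Orthonormal frames and the Grassmannian *)

Section Frames.
Set Implicit Arguments.
Unset Strict Implicit.
Context {R : realType}.
Implicit Types d p : nat.

Definition spanned_by d p (A : 'M[R]_(d, p)) (F : {vspace 'cV[R]_d}) :=
  forall v, v \in F <-> exists c : 'cV[R]_p, v = A *m c.

Definition orthonormal d p (A : 'M[R]_(d, p)) := A^T *m A = 1%:M.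

Lemma mulmx_sum_col d p (A : 'M[R]_(d, p)) (c : 'cV_p) :
  A *m c = \sum_j c j 0 *: (columns A)`_j.
Proof.
apply/matrixP => i j; rewrite ord1 mxE summxE; apply: eq_bigr => k _.
by rewrite -tnth_nth tnth_mktuple !mxE mulrC.
Qed.

Lemma span_columns d p (A : 'M[R]_(d, p)) :
  spanned_by A <<columns A>>%VS.
Proof.
move=> v; split => [vA|[c ->]].
  exists (\col_j coord (columns A) j v); rewrite mulmx_sum_col.
  by rewrite {1}(coord_span vA); apply: eq_bigr => j _; rewrite mxE.
rewrite mulmx_sum_col; apply: memv_suml => j _; apply: memvZ.
by apply/memv_span/mem_nth; rewrite size_tuple.
Qed.

Lemma free_columnsP d p (A : 'M[R]_(d, p)) :
  free (columns A) <-> forall c : 'cV_p, A *m c = 0 -> c = 0.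
Proof.
split => [/freeP fA c|Ai].
  rewrite mulmx_sum_col => /fA c0; apply/colP => j.
  by rewrite c0 mxE.
apply/freeP => k k0 i.
have := Ai (\col_j k j); rewrite mulmx_sum_col.
under eq_bigr do rewrite mxE.
by move=> /(_ k0)/colP/(_ i); rewrite !mxE.
Qed.

Lemma spanned_by_uniq d p (A : 'M[R]_(d, p)) F G :
  spanned_by A F -> spanned_by A G -> F = G.
Proof.
move=> AF AG; apply/vspaceP => v; apply/idP/idP => [/AF/AG|/AG/AF] //.
Qed.

Lemma orthonormal_inj d p (A : 'M[R]_(d, p)) :
  orthonormal A -> forall c : 'cV_p, A *m c = 0 -> c = 0.
Proof. by move=> AA c Ac; rewrite -[c]mul1mx -AA -mulmxA Ac mulmx0. Qed.

(** One Gram-Schmidt step: the component of the new column orthogonal to the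
    columns already treated is the image under [A] of a vector with first
    coordinate 1, so it is nonzero and can be normalized. *)
Lemma gram_schmidt d p (A : 'M[R]_(d, p)) :
  (forall c : 'cV_p, A *m c = 0 -> c = 0) ->
  exists T : 'M[R]_p, orthonormal (A *m T).
Proof.
elim: p A => [|p IH] A Ai.
  by exists 0; apply/matrixP; case.
rewrite /orthonormal -(add1n p) in A Ai *.
have [|T TA] := IH (rsubmx A).
  move=> c Ac; have := Ai (col_mx 0 c).
  rewrite -[A]hsubmxK mul_row_col mulmx0 add0r => /(_ Ac).
  by move=> /(congr1 dsubmx); rewrite col_mxKd linear0.
set a := lsubmx A; set Q := rsubmx A *m T; rewrite -/Q in TA.
set q := T *m Q^T *m a; set u := a - rsubmx A *m q.
have uE : u = A *m col_mx 1%:M (- q).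
  by rewrite -{1}[A]hsubmxK mul_row_col mulmx1 mulmxN.
have Qu : Q^T *m u = 0.
  by rewrite /u /q mulmxBr !mulmxA -[Q^T *m _ *m T]mulmxA TA mul1mx subrr.
have uQ : u^T *m Q = 0 by rewrite -[Q]trmxK -trmx_mul Qu trmx0.
have uu : u^T *m u = (\sum_i u i 0 ^+ 2)%:M.
  apply/matrixP => i j; rewrite !ord1 !mxE eqxx mulr1n.
  by apply: eq_bigr => k _; rewrite !mxE expr2.
set s := \sum_i u i 0 ^+ 2 in uu.
have s_gt0 : 0 < s.
  rewrite lt_neqAle sumr_ge0 ?andbT; last by move=> i _; exact: sqr_ge0.
  apply/eqP => /esym/eqP; rewrite psumr_eq0; last by move=> i _; exact: sqr_ge0.
  move=> /allP u0; have : u = 0.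
    apply/colP => i; rewrite [RHS]mxE; apply/eqP.
    by have := u0 i (mem_index_enum _); rewrite sqrf_eq0.
  rewrite uE => /Ai/(congr1 usubmx); rewrite col_mxKu linear0.
  by move=> /matrixP/(_ 0 0)/eqP; rewrite !mxE eqxx oner_eq0.
pose r := (Num.sqrt s)^-1.
exists (block_mx r%:M 0 (- r *: q) T).
have -> : A *m block_mx r%:M 0 (- r *: q) T = row_mx (r *: u) Q.
  rewrite -{1}[A]hsubmxK mul_row_block mulmx0 add0r; congr row_mx.
  by rewrite mul_mx_scalar -scalemxAr scalerBr scaleNr.
have ruT : (r *: u)^T = r *: u^T by rewrite linearZ.
have ru : (r *: u)^T *m (r *: u) = 1%:M.
  rewrite ruT -scalemxAl -scalemxAr uu scalerA -expr2 exprVn.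
  by rewrite sqr_sqrtr ?ltW // scale_scalar_mx mulVf ?gt_eqF.
have ruQ : (r *: u)^T *m Q = 0 by rewrite ruT -scalemxAl uQ scaler0.
have Qru : Q^T *m (r *: u) = 0 by rewrite -scalemxAr Qu scaler0.
by rewrite tr_row_mx mul_col_row TA ru ruQ Qru -scalar_mx_block.
Qed.

(** Orthonormality of [A *m T] forces [T] to be invertible, so that the change
    of frame preserves the span. *)
Lemma spanned_by_mulmx d p (A : 'M[R]_(d, p)) (T : 'M[R]_p) F :
  orthonormal (A *m T) -> spanned_by A F -> spanned_by (A *m T) F.
Proof.
rewrite /orthonormal mulmxA => /mulmx1_unit[_ Tu] AF v.
rewrite AF; split => -[c ->].
  by exists (invmx T *m c); rewrite -mulmxA mulKVmx.
by exists (T *m c); rewrite mulmxA.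
Qed.

Lemma orthonormal_frame d p (F : Gr R d p) :
  exists2 A : 'M[R]_(d, p), orthonormal A & spanned_by A (\val F).
Proof.
have [B fB FB] : exists2 X : p.-tuple 'cV[R]_d, free X & <<X>>%VS = \val F.
  have dF := eqP (valP F).
  exists (tcast dF (vbasis (\val F))).
    by have /basis_free := vbasisP (\val F); rewrite val_tcast.
  by have /span_basis := vbasisP (\val F); rewrite val_tcast.
pose A := \matrix_(i, j) (tnth B j) i 0.
have BA : columns A = B.
  apply: eq_from_tnth => j; rewrite tnth_mktuple.
  by apply/colP => i; rewrite !mxE.
rewrite -BA in fB FB.
have [T AT] := gram_schmidt ((free_columnsP A).1 fB).
by exists (A *m T) => //; apply: spanned_by_mulmx => //; rewrite -FB;
  exact: span_columns.
Qed.

(** Every [p]-dimensional subspace has an orthonormal frame, so this compactness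
    plays the role of the compactness of the Grassmannian. *)
Lemma compact_orthonormal d p :
  compact [set A : 'M[R]_(d, p) | orthonormal A].
Proof.
apply: (@bounded_closed_compact_mx _ _ _ _ 1) => [A AA|].
  apply: norm_mx_le => // i j.
  have : \sum_k A k j ^+ 2 = 1.
    transitivity ((A^T *m A) j j); last by rewrite AA mxE eqxx.
    by rewrite mxE; apply: eq_bigr => k _; rewrite mxE expr2.
  rewrite (bigD1 i) //= => Aj.
  rewrite -(@ler_pXn2r _ 2) ?nnegrE // expr1n -normrX ger0_norm ?sqr_ge0 //.
  by rewrite -Aj lerDl sumr_ge0 // => k _; exact: sqr_ge0.
have c : continuous (fun A : 'M[R]_(d, p) => A^T *m A).
  apply: continuous_mulmx; last by move=> ?; exact: cvg_id.
  apply: continuous_coords => i j.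
  under eq_fun do rewrite mxE.
  exact: coord_continuous.
apply: ((continuous_closedP _).1 c [set 1%:M]).
apply: accessible_closed_set1; apply: hausdorff_accessible.
exact: norm_hausdorff.
Qed.

(** The topology of the Grassmannian is the quotient topology from frames, so a
    limit of frames of members of a closed set spans a member of it. *)
Lemma limit_of_frames d p (FF : set (Gr R d p)) (A : 'M[R]_(d, p)) :
  closed FF -> orthonormal A ->
  (forall e, 0 < e -> exists A' F, [/\ `|A - A'| < e, orthonormal A',
     spanned_by A' (\val F) & FF F]) ->
  exists2 F, FF F & spanned_by A (\val F).
Proof.
move=> FFcl AA lim.
have frame (B : 'M[R]_(d, p)) : orthonormal B -> free (columns B).
  by move=> BB; apply/free_columnsP; exact: orthonormal_inj.
pose S B (BB : orthonormal B) : Stiefel R d p :=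
  exist _ B (mem_set (frame B BB)).
exists (frame_span (S A AA)); last exact: span_columns.
have [//|nFF] := pselect (FF (frame_span (S A AA))).
have FFo : open (~` FF) by exact: closed_openC.
have [W Wo WE] : Gr_open (~` FF) := FFo.
have WA : W A.
  by have : (\val @^-1` W) (S A AA) by rewrite WE.
have /nbhs_normP[e /= e0 We] := open_nbhs_nbhs (conj Wo WA).
have [A' [F [AA' A'A' A'F FFF]]] := lim _ e0.
have : (\val @^-1` W) (S A' A'A') by apply: We.
rewrite WE /=; have -> : frame_span (S A' A'A') = F; last by [].
by apply: val_inj; exact: spanned_by_uniq (@span_columns _ _ A') A'F.
Qed.

End Frames.

(** * Norm estimates, transversality and limits *)

Section Auxiliary.
Set Implicit Arguments.
Unset Strict Implicit.
Context {R : realType}.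
Implicit Types d p : nat.

Lemma norm_le_enorm d (x : 'cV[R]_d) : `|x| <= enorm x.
Proof.
apply: norm_mx_le => [|i j]; first exact: sqrtr_ge0.
rewrite ord1 -sqrtr_sqr ler_sqrt; last first.
  by apply: sumr_ge0 => k _; exact: sqr_ge0.
by rewrite (bigD1 i) //= lerDl sumr_ge0 // => k _; exact: sqr_ge0.
Qed.

Lemma enorm_le_norm d (x : 'cV[R]_d) : enorm x <= d%:R * `|x|.
Proof.
rewrite -[leRHS]ger0_norm ?mulr_ge0 // -sqrtr_sqr ler_sqrt ?sqr_ge0 //.
apply: (@le_trans _ _ (d%:R * `|x| ^+ 2)).
  rewrite -[d in d%:R]card_ord mulr_natl -sumr_const; apply: ler_sum => i _.
  by rewrite -real_normK ?num_real // ler_pXn2r ?nnegrE // entry_le_norm.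
rewrite exprMn ler_wpM2r ?sqr_ge0 // -natrX ler_nat.
by case: (d) => // k; rewrite leq_pmulr.
Qed.

(** A perturbation of the identity by [E] with [d%:R * `|E| <= 1/2] is at least
    half-expanding, hence invertible with inverse of norm at most 2. *)
Lemma solve_near_id d (E : 'M[R]_d) (w : 'cV[R]_d) :
  d%:R * `|E| <= 2^-1 ->
  exists2 z, (1%:M + E) *m z = w & `|z| <= 2 * `|w|.
Proof.
move=> E2; have half (z : 'cV[R]_d) : `|z| <= 2 * `|(1%:M + E) *m z| :> R.
  have : `|z| <= `|(1%:M + E) *m z| + `|E *m z|.
    by rewrite {1}(_ : z = (1%:M + E) *m z - E *m z) ?ler_normB//
      mulmxDl mul1mx addrK.
  have : `|E *m z| <= 2^-1 * `|z|.
    by apply: le_trans (norm_mulmx_le _ _) _; rewrite mulrA ler_wpM2r.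
  lra.
have u : (1%:M + E) \in unitmx.
  rewrite -unitmx_tr unitmxE unitfE; apply/negP => /det0P[v v0 vE].
  have := half v^T; rewrite -[_ *m v^T]trmxK trmx_mul trmxK vE trmx0.
  by rewrite normr0 mulr0 normr_le0 trmx_eq0; apply/negP.
exists (invmx (1%:M + E) *m w); first by rewrite mulKVmx.
by apply: le_trans (half _) _; rewrite mulKVmx.
Qed.

(** Transversality is an open condition, with a quantitative bound.  Splitting
    the standard basis along [F + G] gives [A *m M + N = 1%:M] with the columns
    of [N] in [G]; replacing [A] by [A'] perturbs the identity by
    [(A' - A) *m M], and [solve_near_id] inverts the result. *)
Lemma solve_transverse d p (A : 'M[R]_(d, p)) (F G : {vspace 'cV[R]_d})
    (eta : R) :
  spanned_by A F -> (F + G)%VS = fullv -> 0 < eta ->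
  exists2 e, 0 < e & forall (A' : 'M[R]_(d, p)) w, `|A - A'| < e -> `|w| < e ->
    exists c u, [/\ u \in G, `|u| < eta, `|A' *m c| < eta & w = A' *m c + u].
Proof.
move=> AF FG eta0.
have dec j : {mn : 'cV[R]_p * 'cV[R]_d |
    mn.2 \in G /\ delta_mx j 0 = A *m mn.1 + mn.2}.
  apply: cid; have : delta_mx j 0 \in (F + G)%VS by rewrite FG memvf.
  by move=> /memv_addP[_ /AF[m ->]] [n nG ->]; exists (m, n).
pose M := \matrix_(i, j) (sval (dec j)).1 i 0.
pose N := \matrix_(i, j) (sval (dec j)).2 i 0.
have colN j : col j N = (sval (dec j)).2 by apply/colP => i; rewrite !mxE.
have AMN : A *m M + N = 1%:M.
  apply/matrixP => i j; have [_ /colP/(_ i)] := svalP (dec j).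
  rewrite !mxE eqxx andbT => ->; congr (_ + _).
  by apply: eq_bigr => k _; rewrite !mxE.
have NG z : N *m z \in G.
  rewrite mulmx_sum_col; apply: memv_suml => j _; apply: memvZ.
  rewrite -tnth_nth tnth_mktuple colN.
  by have [] := svalP (dec j).
(* [a] makes the perturbation of the identity at most [1/2] in [solve_near_id],
   and [b] times the norm of [w] bounds the norms of both pieces. *)
pose a := 1 + 2 * (d%:R * (p%:R * `|M|)).
pose b := 2 * (1 + 2 * (d%:R * `|N|)).
have a0 : 0 < a by rewrite ltr_pwDl // !mulr_ge0.
have b0 : 0 < b by rewrite mulr_gt0 // ltr_pwDl // !mulr_ge0.
exists (Num.min a^-1 (eta / b)); first by rewrite lt_min invr_gt0 a0 divr_gt0.
move=> A' w; rewrite !lt_min => /andP[Aa _] /andP[_ wb].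
pose E := (A' - A) *m M.
have E2 : d%:R * `|E| <= 2^-1.
  have : `|E| <= p%:R * (a^-1 * `|M|).
    apply: le_trans (norm_mulmx_le _ _) _; rewrite ler_wpM2l // ler_wpM2r //.
    by rewrite distrC ltW.
  move=> /(ler_wpM2l (ler0n R d)) /le_trans; apply.
  have -> : d%:R * (p%:R * (a^-1 * `|M|)) = (d%:R * (p%:R * `|M|)) / a.
    by rewrite [a^-1 * _]mulrC !mulrA.
  rewrite ler_pdivrMr // /a; lra.
have [z zw zw2] := solve_near_id w E2.
have split : w = A' *m (M *m z) + N *m z.
  by rewrite -zw -AMN /E mulmxBl addrC addrA subrK mulmxDl mulmxA.
have wlt : `|w| * b < eta by rewrite -ltr_pdivlMr.
have Nz : `|N *m z| <= 2 * (d%:R * `|N|) * `|w|.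
  apply: le_trans (norm_mulmx_le _ _) _.
  have -> : 2 * (d%:R * `|N|) * `|w| = d%:R * (`|N| * (2 * `|w|)) by ring.
  by rewrite !ler_wpM2l.
have w0 : 0 <= `|w| by [].
rewrite /b in wlt.
have Nw0 : 0 <= d%:R * `|N| * `|w| by rewrite !mulr_ge0.
exists (M *m z), (N *m z); split => //.
  by apply: le_lt_trans Nz _; lra.
have -> : A' *m (M *m z) = w - N *m z by rewrite split addrK.
by apply: le_lt_trans (ler_normB _ _) _; lra.
Qed.

(** Otherwise the set of parameters [t] at which the line is in [Omega] would be
    both open and closed in the connected real line. *)
Lemma boundary_crossing d (Omega : set 'cV[R]_d) x v :
  open Omega -> Omega x -> ~ Omega (x + v) ->
  exists t : R, closure Omega (x + t *: v) /\ ~ Omega (x + t *: v).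
Proof.
move=> Oo Ox nOv; apply: contrapT => nb.
pose f (t : R) := x + t *: v.
have fc : continuous f.
  by move=> t; apply: cvgD; [exact: cvg_cst|exact: cvgZr_tmp].
have clE : f @^-1` Omega = f @^-1` closure Omega.
  rewrite eqEsubset; split => t /=; first exact: subset_closure.
  by move=> ct; apply: contrapT => nO; apply: nb; exists t.
have : f @^-1` Omega = setT.
  have cT : connected [set: R] by apply/connected_intervalP.
  apply: cT.
  - by exists 0; rewrite /= /f scale0r addr0.
  - exists (f @^-1` Omega); last by rewrite setTI.
    by apply: open_comp => // ? _; exact: fc.
  - exists (f @^-1` Omega); last by rewrite setTI.
    rewrite clE; apply: closed_comp => [? _|]; first exact: fc.
    exact: closed_closure.
move=> /seteqP[_ /(_ 1)]; rewrite /= /f scale1r => /(_ I); exact: nOv.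
Qed.

Lemma near_dist (V : normedModType R) (y : V) (e : R) :
  0 < e -> \forall x \near y, `|y - x| < e.
Proof. by move=> e0; have := nbhsx_ballx y e e0; rewrite -ball_normE. Qed.

Lemma uniform_thickening d (Omega K : set 'cV[R]_d) :
  open Omega -> compact K -> K `<=` Omega ->
  exists2 e, 0 < e & forall x w, K x -> `|w| <= e -> Omega (x + w).
Proof.
move=> Oo /compact_near_coveringP Kc KO.
have : \forall e \near 0^'+, K `<=`
    [set x | forall w : 'cV[R]_d, `|w| <= e -> Omega (x + w)].
  apply: Kc => x /KO Ox.
  have /nbhs_normP[r /= r0 rO] := open_nbhs_nbhs (conj Oo Ox).
  have r2 : 0 < r / 2 by rewrite divr_gt0.
  near=> x' e.
  have xx' : `|x - x'| < r / 2.
    by near: x'; exact: (@near_dist 'cV[R]_d x _ r2).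
  have er : e <= r / 2 by near: e; exact: nbhs_right_le.
  move=> w we; apply: rO; rewrite /ball_/= opprD addrA.
  apply: le_lt_trans (ler_normB _ _) _; rewrite [ltRHS](splitr r).
  by apply: ltr_leD => //; exact: le_trans er.
move=> h; near (0 : R)^'+ => e.
exists e; first by near: e; exact: nbhs_right_gt.
move=> x w Kx we; have : K `<=` [set x | forall w : 'cV[R]_d, `|w| <= e ->
   Omega (x + w)] by near: e.
by move=> /(_ x Kx); apply.
Unshelve. all: by end_near.
Qed.

(** The limit is a cluster point, along the trace on [Omega] of the
    neighbourhoods of [y], of a function choosing [A] in terms of [x]. *)
Lemma compact_limit (V W : normedModType R) (Omega : set V) (K : set W) y
    (P : V -> W -> Prop) :
  compact K -> closure Omega y -> (forall x, Omega x -> exists2 A, K A & P x A) ->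
  exists2 A, K A & forall e, 0 < e -> exists x A',
    [/\ Omega x, `|y - x| < e, `|A - A'| < e, K A' & P x A'].
Proof.
move=> Kc Oy ch.
pose f x := if pselect (Omega x) is left Ox then projT1 (cid2 (ch x Ox))
            else point : W.
have fP x : Omega x -> K (f x) /\ P x (f x).
  by rewrite /f; case: pselect => // Ox _; case: (cid2 _).
have PF := within_nbhs_proper Oy.
have [|A [KA clA]] := Kc (f @ within Omega (nbhs y)) _.
  have : \forall x \near within Omega (nbhs y), K (f x).
    near=> x; have Ox : Omega x by near: x; exact: withinT.
    by have [] := fP x Ox.
  by [].
exists A => // e e0.
have [] := clA (f @` [set x | Omega x /\ `|y - x| < e]) [set B | `|A - B| < e].
- suff : \forall x \near within Omega (nbhs y),
      (f @` [set x | Omega x /\ `|y - x| < e]) (f x) by [].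
  near=> x; exists x => //; split; near: x; first exact: withinT.
  by apply: cvg_within; exact: near_dist.
- exact: near_dist.
by move=> _ [[x [Ox yx] <-] Ax]; exists x, (f x); have [] := fP x Ox.
Unshelve. all: by end_near.
Qed.

End Auxiliary.

(** * The boundary is foliated *)

Section BoundaryFoliation.
Set Implicit Arguments.
Unset Strict Implicit.
Context {R : realType} {d p : nat}.
Variables (Omega : set 'cV[R]_d) (H : set (SAff R d)) (FF : set (Gr R d p)).
Hypotheses (d_gt0 : (0 < d)%N) (Omega_open : open Omega).
Hypotheses (H_preserves : preserves H Omega).
Hypotheses (H_proper : acts_properly_on H Omega).
Hypotheses (FF_closed : closed FF)
  (FF_invariant : Gr_invariant (linear_part H) FF).
Hypothesis FF_not_contracted : forall g, linear_part H g ->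
  exists2 F, FF F & not_contracted g (\val F).
Hypothesis FF_transverse : forall F G, FF F -> FF G -> F <> G ->
  (\val F + \val G)%VS = fullv.
Variables (K : set 'cV[R]_d) (eps : R).
Hypotheses (K_compact : compact K) (K_sub : K `<=` Omega).
Hypothesis K_cover : \bigcup_(h in H) (saff_act h @` K) = Omega.
Hypothesis eps_gt0 : 0 < eps.
Hypothesis K_thick : forall x w, K x -> `|w| <= eps -> Omega (x + w).

Implicit Types (x y v w : 'cV[R]_d) (F G : Gr R d p).

Lemma saff_act_add (h : SAff R d) x v :
  saff_act h (x + v) = saff_act h x + \val h.1 *m v.
Proof. by rewrite /saff_act mulmxDr addrAC. Qed.

Lemma Omega_act (h : SAff R d) x : H h -> Omega (saff_act h x) <-> Omega x.
Proof.
move=> Hh; have hO := H_preserves Hh; split; last first.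
  by move=> Ox; rewrite -hO; exists x.
rewrite -{1}hO => -[z Oz /addIr hzx].
by rewrite -(mulKmx (unitmx_SL h.1) x) -hzx mulKmx ?unitmx_SL.
Qed.

(** The element [h] is kept, and not only the conclusion that [x + v] is in
    [Omega], because properness constrains [h] through the two points it moves.
    The factor [d%:R] is the price for comparing Euclidean lengths through the
    sup norm. *)
Definition pushed x v := exists h k w,
  [/\ H h, K k, x = saff_act h k, v = \val h.1 *m w & `|w| <= d%:R * `|v|].

(** The sup norm radius below which pushed vectors start from vectors of norm at
    most [eps]. *)
Let rho := eps / d%:R.

Let rho_gt0 : 0 < rho.
Proof. by rewrite divr_gt0 ?ltr0n. Qed.

Let rhoP v : `|v| < rho -> d%:R * `|v| <= eps.
Proof. by move=> /ltW; rewrite ler_pdivlMr ?ltr0n // mulrC. Qed.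

Lemma pushed_plane x :
  Omega x -> exists2 F, FF F & forall v, v \in \val F -> pushed x v.
Proof.
rewrite -K_cover => -[h Hh [k Kk hkx]].
have Lh : linear_part H h.1 by exists h.
have [F FFF nc] := FF_not_contracted Lh.
exists (Gr_act h.1 F); first by rewrite -(FF_invariant Lh); exists F.
move=> _ /memv_imgP[w Fw ->]; rewrite lfunE /=.
exists h, k, w; split => //.
apply: le_trans (norm_le_enorm _) _; apply: le_trans (nc _ Fw) _.
exact: enorm_le_norm.
Qed.

Lemma pushed_in x v : pushed x v -> `|v| < rho -> Omega (x + v).
Proof.
move=> [h [k [w [Hh Kk -> ->]]]] wv /rhoP vr.
rewrite -saff_act_add; apply/Omega_act => //; apply: K_thick => //.
exact: le_trans vr.
Qed.

Definition boundary y := closure Omega y /\ ~ Omega y.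

Lemma closure_approx y :
  (forall e, 0 < e -> exists2 x, Omega x & `|y - x| < e) -> closure Omega y.
Proof.
move=> approx B /nbhs_ballP[e /= e0 yB]; have [x Ox yx] := approx e e0.
by exists x; split => //; apply: yB; rewrite -ball_normE.
Qed.

Definition limit_plane y F := FF F /\ exists2 A : 'M[R]_(d, p), spanned_by A (\val F) &
  forall e, 0 < e -> exists x (A' : 'M[R]_(d, p)), [/\ Omega x, `|y - x| < e, `|A - A'| < e &
    forall c, pushed x (A' *m c)].

Lemma limit_plane_exists y : closure Omega y -> exists F, limit_plane y F.
Proof.
move=> Oy.
pose P x (A : 'M[R]_(d, p)) := exists F, [/\ FF F, spanned_by A (\val F) &
  forall c, pushed x (A *m c)].
have [|A AA lim] := @compact_limit _ _ _ _ _ _ P (@compact_orthonormal _ d p) Oy.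
  move=> x Ox; have [F FFF xF] := pushed_plane Ox.
  have [A AA AF] := orthonormal_frame F; exists A => //; exists F; split => //.
  by move=> c; apply: xF; apply/AF; exists c.
have [|F FFF AF] := limit_of_frames FF_closed AA.
  by move=> e /lim[x [A' [_ _ AA' A'A' [F [FFF A'F _]]]]]; exists A', F.
exists F; split => //; exists A => // e /lim[x [A' [Ox yx AA' _ [_ [_ _ xA']]]]].
by exists x, A'.
Qed.

Lemma limit_plane_approx y F v : limit_plane y F -> v \in \val F ->
  forall e, 0 < e -> exists x v',
    [/\ Omega x, `|y - x| < e, `|v - v'| < e & pushed x v'].
Proof.
move=> [_ [A AF lim]] /AF[c ->] e e0.
have c0 : 0 < 1 + p%:R * `|c| by rewrite ltr_pwDl // mulr_ge0.
have e'0 : 0 < Num.min e (e / (1 + p%:R * `|c|)).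
  by rewrite lt_min e0 divr_gt0.
have [x [A' [Ox]]] := lim _ e'0; rewrite !lt_min => /andP[yx _] /andP[_ AA'] xA'.
exists x, (A' *m c); split => //; rewrite -mulmxBl.
apply: le_lt_trans (norm_mulmx_le _ _) _.
move: AA'; rewrite ltr_pdivlMr // => AA'.
have AA0 : 0 <= `|A - A'| by [].
by apply: le_lt_trans AA'; rewrite mulrDr mulr1 mulrCA lerDr.
Qed.

(** That [y + v] is not in [Omega] is where properness is used.  Otherwise take
    for [K1] the [eps]-thickening of [K] and for [K2] a ball around [y + v].  The
    [h] witnessing [pushed x v'], for [x] near [y] and [v'] near [v], maps a
    point of [K1] into [K2], hence lies in a fixed compact [C].  Then [x] lies
    in [D = C K], a compact subset of [Omega], which thus contains the limit
    [y]. *)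
Lemma limit_plane_boundary y F v : boundary y -> limit_plane y F ->
  v \in \val F -> `|v| < rho -> boundary (y + v).
Proof.
move=> [Oy nOy] yF vF vr; have approx := limit_plane_approx yF vF.
have vr0 : 0 < rho - `|v| by rewrite subr_gt0.
have small v' : `|v - v'| < rho - `|v| -> `|v'| < rho.
  rewrite distrC => vv'; rewrite -[v'](subrK v).
  by apply: le_lt_trans (ler_normD _ _) _; rewrite -ltrBrDr.
split.
  apply: closure_approx => e e0.
  have e'0 : 0 < Num.min (rho - `|v|) (e / 2) by rewrite lt_min vr0 divr_gt0.
  have [x [v' [Ox]]] := approx _ e'0.
  rewrite !lt_min => /andP[_ yx] /andP[/small v'r vv'] xv'.
  exists (x + v'); first exact: pushed_in.
  rewrite opprD addrACA (splitr e); apply: le_lt_trans (ler_normD _ _) _.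
  exact: ltrD.
move=> Oyv.
have [r r0 rO] : exists2 r, 0 < r & forall w, `|w| <= r -> Omega (y + v + w).
  have [|r r0 rO] := uniform_thickening Omega_open (@compact_set1 _ (y + v)).
    by move=> _ ->.
  by exists r => // w; exact: rO.
have ball_compact s : compact [set w : 'cV[R]_d | `|w| <= s].
  apply: (@bounded_closed_compact_mx _ _ _ _ s) => //.
  have := @closed_comp _ _ (fun w : 'cV[R]_d => `|w|) [set t | t <= s].
  by apply; [move=> w _; exact: norm_continuous | exact: closed_le].
have sum_compact (K1 K2 : set 'cV[R]_d) : compact K1 -> compact K2 ->
    compact [set x | exists a b, [/\ K1 a, K2 b & x = a + b]].
  move=> K1c K2c.
  have -> : [set x | exists a b, [/\ K1 a, K2 b & x = a + b]] =
      (fun z => z.1 + z.2) @` (K1 `*` K2).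
    rewrite eqEsubset; split => [x [a [b [Ka Kb ->]]]|_ [[a b] [Ka Kb] <-]].
      by exists (a, b).
    by exists a, b.
  apply: continuous_compact; last exact: compact_setX.
  by apply: continuous_subspaceT => z; exact: add_continuous.
pose K1 := [set x | exists a b, [/\ K a, `|b| <= eps & x = a + b]].
pose K2 := [set x | exists a b, [/\ a = y + v, `|b| <= r & x = a + b]].
have K1c : compact K1 := sum_compact _ _ K_compact (ball_compact eps).
have K2c : compact K2 := sum_compact _ _ (@compact_set1 _ (y + v)) (ball_compact r).
have K12O : K1 `|` K2 `<=` Omega.
  move=> _ [[a [b [Ka bb ->]]]|[a [b [-> bb ->]]]]; first exact: K_thick.
  exact: rO.
have Cc := H_proper (compactU K1c K2c) K12O.
set C := [set h | _] in Cc.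
pose D := (fun hx : SAff R d * 'cV[R]_d => saff_act hx.1 hx.2) @` (C `*` K).
have Dcl : closed D.
  apply: compact_closed; first exact: norm_hausdorff.
  apply: continuous_compact; last exact: compact_setX.
  apply: continuous_subspaceT; exact: continuous_saff_act.
have nDy : ~ D y.
  move=> [[h k] [[Hh _] /= Kk] hky]; apply: nOy; rewrite -hky.
  by apply/Omega_act => //; exact: K_sub.
apply/nDy/Dcl => B /nbhs_ballP[e /= e0 yB].
have e'0 : 0 < Num.min (Num.min e (rho - `|v|)) (r / 2).
  by rewrite !lt_min e0 vr0 divr_gt0.
have [x [v' [Ox]]] := approx _ e'0.
rewrite !lt_min => /andP[/andP[xe _] xr] /andP[/andP[_ /small v'r] v'r2].
move=> [h [k [w [Hh Kk xE vE wv]]]].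
exists x; split; last by apply: yB; rewrite -ball_normE.
exists (h, k) => //=; split => //=; split => //.
exists (x + v'); split.
  exists (k + w); last by rewrite saff_act_add -xE -vE.
  left; exists k, w; split => //.
  by apply: le_trans wv _; exact: rhoP.
right; exists (y + v), (x + v' - (y + v)); split => //; last by rewrite [RHS]addrC subrK.
rewrite distrC opprD addrACA (splitr r); apply: le_trans (ler_normD _ _) _.
by apply/ltW/ltrD.
Qed.

(** If [G] were different from [F], it would be transverse to [F], hence to the
    frames [A'] at the points [x] close to [y]; the disc of [Omega] at [x] would
    then meet the disc [y + G]. *)
Lemma limit_plane_eq y F G (eta : R) : limit_plane y F -> FF G -> 0 < eta ->
  (forall u, u \in \val G -> `|u| < eta -> ~ Omega (y + u)) -> F = G.
Proof.
move=> [FFF [A AF lim]] FFG eta0 nO; apply: contrapT => /(FF_transverse FFF FFG).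
move=> FG; have eta'0 : 0 < Num.min eta rho by rewrite lt_min eta0.
have [e e0 solve] := solve_transverse AF FG eta'0.
have [x [A' [Ox yx AA' xA']]] := lim e e0.
have [c [u [uG]]] := solve A' (y - x) AA' yx.
rewrite !lt_min => /andP[ue _] /andP[_ Ac] yxE.
apply: (nO (- u)); first by rewrite memvN.
  by rewrite normrN.
have -> : y - u = x + A' *m c.
  by apply/eqP; rewrite subr_eq -addrA -yxE [eqbRHS]addrC subrK.
exact: pushed_in.
Qed.

(** Each step is a vector [v] of norm less than [rho], which stays in the disc
    given by [limit_plane_boundary] at the point reached so far.  That disc,
    seen from its point [z + v], is still a neighbourhood of [z + v] in [z + F],
    so [limit_plane_eq] identifies the limit planes there with [F]. *)
Lemma leaf_steps y F v n : boundary y -> limit_plane y F -> v \in \val F ->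
  `|v| < rho -> boundary (y + v *+ n) /\
  forall F', limit_plane (y + v *+ n) F' -> F' = F.
Proof.
move=> yb yF vF vr; have FFF := yF.1; elim: n => [|n [zb zuniq]].
  rewrite mulr0n addr0; split => // F' yF'.
  apply: (limit_plane_eq yF' FFF rho_gt0) => u uF ur.
  by have [] := limit_plane_boundary yb yF uF ur.
have [F' zF] := limit_plane_exists zb.1.
have E := zuniq _ zF; rewrite E {F' E} in zF.
rewrite mulrSr addrA; split; first exact: limit_plane_boundary zF vF vr.
have vr0 : 0 < rho - `|v| by rewrite subr_gt0.
move=> F' zF'; apply: (limit_plane_eq zF' FFF vr0) => u uF ur.
have vu : `|v + u| < rho.
  by apply: le_lt_trans (ler_normD _ _) _; rewrite -ltrBrDl.
by rewrite -[_ + u]addrA; have [] := limit_plane_boundary zb zF (memvD vF uF) vu.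
Qed.

Lemma leaf y F v : boundary y -> limit_plane y F -> v \in \val F ->
  boundary (y + v) /\ forall F', limit_plane (y + v) F' -> F' = F.
Proof.
move=> yb yF vF; pose n := (Num.bound (`|v| / rho)).+1.
have nv : v = (n%:R^-1 *: v) *+ n.
  by rewrite -scaler_nat scalerA divff ?scale1r // pnatr_eq0.
rewrite nv; apply: leaf_steps => //; first exact: memvZ.
rewrite normrZ ger0_norm ?invr_ge0 // mulrC ltr_pdivrMr ?ltr0n // mulrC.
rewrite -ltr_pdivrMr //; apply: lt_le_trans (archi_boundP _) _.
  by rewrite divr_ge0 // ltW.
by rewrite ler_nat.
Qed.

(** Transverse leaves intersect, and at a common point both directions agree
    with the limit plane there. *)
Lemma limit_plane_unique y z F G :
  boundary y -> boundary z -> limit_plane y F -> limit_plane z G -> F = G.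
Proof.
move=> yb zb yF zG; apply: contrapT => FG.
have full := FF_transverse yF.1 zG.1 FG.
have : z - y \in (\val F + \val G)%VS by rewrite full memvf.
move=> /memv_addP[a aF [b bG zyE]].
have [wb wF] := leaf yb yF aF.
have Nb : - b \in \val G by rewrite memvN.
have [_ wG] := leaf zb zG Nb.
have wE : z - b = y + a.
  by apply/eqP; rewrite subr_eq -addrA -zyE [eqbRHS]addrC subrK.
rewrite wE in wG.
have [F' wF'] := limit_plane_exists wb.1.
by apply: FG; rewrite -(wF _ wF') (wG _ wF').
Qed.

Lemma boundary_act (h : SAff R d) y : H h -> boundary y -> boundary (saff_act h y).
Proof.
move=> Hh [Oy nOy]; split; last by move/Omega_act => /(_ Hh).
have hc : continuous (saff_act h).
  have mc : continuous (fun x => \val h.1 *m x).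
    apply: (@continuous_mulmx _ 'cV[R]_d _ _ _ (fun=> \val h.1) id) => z.
      exact: cst_continuous.
    exact: cvg_id.
  have tc : continuous (fun _ : 'cV[R]_d => h.2).
    by move=> z; exact: cst_continuous.
  by move=> z; exact: (@cvgD _ _ _ _ (nbhs_filter z) _ _ _ _ (mc z) (tc z)).
move=> B /hc /Oy[x [Ox Bx]]; exists (saff_act h x); split => //.
exact/Omega_act.
Qed.

(** The leaf of [y] is carried by [h] to a subset of the boundary through
    [h y] parallel to [Gr_act g F], so [limit_plane_eq] applies to it at [h y],
    where the limit plane is again [F]. *)
Lemma limit_plane_invariant y F g : boundary y -> limit_plane y F ->
  linear_part H g -> Gr_act g F = F.
Proof.
move=> yb yF Lg; have [h Hh hg] := Lg.
have hyb := boundary_act Hh yb; have [F' hyF'] := limit_plane_exists hyb.1.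
rewrite {2}(limit_plane_unique yb hyb yF hyF').
apply/esym/(limit_plane_eq hyF' _ ltr01).
  by rewrite -(FF_invariant Lg); exists F => //; exact: yF.1.
move=> _ /memv_imgP[v vF ->] _; rewrite lfunE /= -hg -saff_act_add.
by have [/(boundary_act Hh)[]] := leaf yb yF vF.
Qed.

(** A segment from [x] in direction [F] leaving [Omega] would meet the boundary
    at a point whose leaf contains [x]. *)
Lemma foliated_limit_plane y F :
  boundary y -> limit_plane y F -> foliated_parallel Omega (\val F).
Proof.
move=> yb yF x Ox _ [v vF <-]; apply: contrapT => nOxv.
have [t zb] := boundary_crossing Omega_open Ox nOxv.
have [F' zF] := limit_plane_exists zb.1.
rewrite (limit_plane_unique yb zb yF zF) in vF.
have tvF : - (t *: v) \in \val F' by rewrite memvN memvZ.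
by have [[_ +] _] := leaf zb zF tvF; rewrite addrK.
Qed.

End BoundaryFoliation.

Theorem proposition2 (R : realType) (d p : nat)
    (Omega : set 'cV[R]_d) (H : set (SAff R d)) (FF : set (Gr R d p))
    (Omega_domain : domain Omega) (Omega_proper : Omega <> setT)
    (H_group : group_closed (mem H)) (H_preserves : preserves H Omega)
    (H_proper : acts_properly_on H Omega)
    (H_cocompact : acts_cocompactly_on H Omega)
    (p_ge1 : (1 <= p)%N) (p_le : (p <= d - 1)%N)
    (FF_closed : closed FF) (FF_invariant : Gr_invariant (linear_part H) FF)
    (FF_not_contracted : forall g, linear_part H g ->
       exists2 F, FF F & not_contracted g (\val F))
    (FF_transverse : forall F G, FF F -> FF G -> F <> G ->
       (\val F + \val G)%VS = fullv) :
  exists F, [/\ FF F, (forall g, linear_part H g -> Gr_act g F = F)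
    & foliated_parallel Omega (\val F)].
Proof.
have d_gt0 : (0 < d)%N.
  by rewrite lt0n; apply: contraTneq p_le => ->; rewrite -ltnNge.
have [[x Ox] _ Oo] := Omega_domain.
have [K [Kc KO Kcov]] := H_cocompact.
have [eps eps0 thick] := uniform_thickening Oo Kc KO.
have [z nOz] : exists z, ~ Omega z.
  by apply: contrapT => nz; apply: Omega_proper; rewrite -subTset => z _;
    apply: contrapT => nOz; apply: nz; exists z.
have [|t yb] := @boundary_crossing _ _ _ _ (z - x) Oo Ox.
  by rewrite addrC subrK.
have [F yF] := limit_plane_exists FF_closed FF_invariant FF_not_contracted Kcov yb.1.
exists F; split; first exact: yF.1.
- move=> g; exact: (limit_plane_invariant d_gt0 _ _ _ _ _ _ _ Kc KO Kcov eps0 thick yb yF).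
- exact: (foliated_limit_plane d_gt0 _ _ _ _ _ _ _ Kc KO Kcov eps0 thick yb yF).
Qed.
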